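(* For every integer $a\geq1$, $$B_{a+1}=\bigl(C_a\cap E_a(B_1)\bigr)\cup\bigl(B_a\cap E_a(C_1)\bigr),\qquad C_{a+1}=\bigl(C_a\cap E_a(C_1)\bigr)\cup\bigl(B_a\cap E_a(B_1)\bigr).$$
   Context: $\mathbb{N}_0=\{0,1,2,\dots\}$. $t(n)$ is the Thue–Morse sequence: $t(n)=0$ if the binary expansion of $n$ has an even number of $1$'s, $t(n)=1$ otherwise. For $a\ge1$, $B_a=\{x\in\mathbb{N}_0: t(x+a)=1-t(x)\}$ and $C_a=\{x\in\mathbb{N}_0: t(x+a)=t(x)\}$. For a set of integers $A$ and $h\in\mathbb{Z}$, $E_h(A)=\{y-h: y\in A\}$. *)

(* Defs.v *)
From mathcomp Require Import all_boot all_order all_algebra.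
From mathcomp Require Import classical_sets.

Set Implicit Arguments.
Unset Strict Implicit.
Unset Printing Implicit Defensive.

Import GRing.Theory.
Local Open Scope classical_set_scope.
Local Open Scope ring_scope.

(* The binary digit of n of weight 2 ^ i is odd (n %/ 2 ^ i). As n < 2 ^ n, the
   digits of index i >= n all vanish, so i < n covers the whole expansion. *)
Definition binary_ones (n : nat) : nat := (\sum_(i < n) odd (n %/ 2 ^ i))%N.

(* Valued in int, so that 1 - t n is a genuine subtraction. *)
Definition t (n : nat) : int := if odd (binary_ones n) then 1 else 0.

(* B a and C a consist of nonnegative integers, but they are typed as sets of
   integers because a shift of such a set may contain negative elements. *)
Definition B (a : nat) : set int :=
  [set x%:Z | x in [set x : nat | t (x + a)%N = 1 - t x]].

Definition C (a : nat) : set int :=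
  [set x%:Z | x in [set x : nat | t (x + a)%N = t x]].

Definition E (h : int) (A : set int) : set int := [set y - h | y in A].

(* Main.v *)
Require Import Defs.
From mathcomp Require Import all_boot all_order all_algebra.
From mathcomp Require Import classical_sets.

Local Open Scope classical_set_scope.
Local Open Scope ring_scope.

(** Pass from [x] to [x + a + 1] through [x + a]. Since [t] has only two values, it changes over the
    whole passage exactly when it changes on one of the two legs and not on the other. Membership in
    [B a] or [C a] records the first leg; by [E_nat], membership in the shifted [B 1] or [C 1]
    records the second. [B_nat] and [C_nat] turn this into a statement about parities. *)

Lemma B_nat (a x : nat) :
  B a x%:Z <-> odd (binary_ones (x + a)) = ~~ odd (binary_ones x).
Proof.
rewrite /B /t; split=> [[y /= h [<-]]|h]; last exists x => //=; move: h;
  by do 2 case: (odd _).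
Qed.

Lemma C_nat (a x : nat) :
  C a x%:Z <-> odd (binary_ones (x + a)) = odd (binary_ones x).
Proof.
rewrite /C /t; split=> [[y /= h [<-]]|h]; last exists x => //=; move: h;
  by do 2 case: (odd _).
Qed.

Lemma E_nat (a x : nat) (A : set int) : E a%:Z A x%:Z <-> A (x + a)%N%:Z.
Proof.
split=> [[y Ay xE]|Axa]; first by rewrite PoszD -xE GRing.subrK.
by exists (x + a)%N%:Z; rewrite // PoszD GRing.addrK.
Qed.

(** The shifted sets may contain negative integers, where the parity criteria say nothing; this
    confines the comparison to natural numbers. *)
Lemma eq_set_nat (U V : set int) :
    (forall z, U z -> exists x : nat, z = x%:Z) ->
    (forall z, V z -> exists x : nat, z = x%:Z) ->
  (forall x : nat, U x%:Z <-> V x%:Z) -> U = V.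
Proof.
move=> natU natV UV; apply/seteqP; split=> z.
  by move=> /[dup] /natU[x ->] /UV.
by move=> /[dup] /natV[x ->] /UV.
Qed.

Lemma B_sub_nat (a : nat) (z : int) : B a z -> exists x : nat, z = x%:Z.
Proof. by case=> x _ <-; exists x. Qed.

Lemma C_sub_nat (a : nat) (z : int) : C a z -> exists x : nat, z = x%:Z.
Proof. by case=> x _ <-; exists x. Qed.

Theorem theorem3 (a : nat) (ha : (1 <= a)%N) :
  B (a + 1)%N = (C a `&` E a%:Z (B 1)) `|` (B a `&` E a%:Z (C 1)) /\
  C (a + 1)%N = (C a `&` E a%:Z (C 1)) `|` (B a `&` E a%:Z (B 1)).
Proof.
split; apply: eq_set_nat; try exact: B_sub_nat; try exact: C_sub_nat;
  (* Each shifted set is intersected with [C a] or [B a], which removes its negative elements. *)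
  try by move=> z [[/C_sub_nat]|[/B_sub_nat]].
- move=> x; rewrite /setU /setI /= !E_nat !B_nat !C_nat addnA.
  (* The three parities are those at [x], [x + a] and [x + a + 1]. *)
  by do 3 case: (odd _); intuition.
- move=> x; rewrite /setU /setI /= !E_nat !B_nat !C_nat addnA.
  by do 3 case: (odd _); intuition.
Qed.
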